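(* Let $p$ be an odd prime, $q=p^f$ with $f\ge1$, let $r\ge1$, let $K_0=W(\mathbb F_q)[1/p]$, and let $K/K_0$ be a finite extension with ring of integers $\mathcal O_K$ and maximal ideal $\mathfrak m_K$. Let $[q]$ be the multiplication-by-$q$ endomorphism of the formal torus $\widehat{\mathbf G}_m^{\,r}$, given in multiplicative coordinates by $[q](Q_1,\dots,Q_r)=(Q_1^q,\dots,Q_r^q)$. Then $[q]$ is a strict contraction on $\widehat{\mathbf G}_m^{\,r}(\mathcal O_K)=(1+\mathfrak m_K)^r$. Every orbit converges to the unit point, which is the unique periodic point.
   Context: $(1+\mathfrak m_K)^r$ carries the sup metric induced by the absolute value of $K$. A strict contraction is a self-map for which there is a constant $c<1$ such that the distance between images is at most $c$ times the original distance. *)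

(* Defs.v *)
From HB Require Import structures.
From mathcomp Require Import all_boot all_order all_algebra all_field.
From mathcomp Require Import all_classical all_reals all_analysis.

Set Implicit Arguments.
Unset Strict Implicit.
Unset Printing Implicit Defensive.

Import Order.TTheory GRing.Theory Num.Theory.
Import numFieldNormedType.Exports.
Local Open Scope classical_set_scope.
Local Open Scope ring_scope.

(* W is the ring W(k) of Witt vectors of the perfect field k, in Serre's sense:
   the strict p-ring with residue field k, which is unique up to unique
   isomorphism compatible with the reduction map res.  The last two fields say
   that W is Hausdorff and complete for the p-adic topology. *)
Record is_Witt (p : nat) (k : fieldType) (W : comNzRingType)
    (res : {rmorphism W -> k}) : Prop := IsWitt {
  Witt_res_surj : forall a : k, exists w : W, res w = a ;
  Witt_res_ker : forall w : W, res w = 0 <-> exists y : W, w = p%:R * y ;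
  Witt_torsion_free : forall w : W, p%:R * w = 0 -> w = 0 ;
  Witt_separated : forall w : W,
    (forall n : nat, exists y : W, w = p%:R ^+ n * y) -> w = 0 ;
  Witt_complete : forall u : nat -> W,
    (forall n : nat, exists y : W, u n.+1 - u n = p%:R ^+ n * y) ->
    exists l : W, forall n : nat, exists y : W, u n - l = p%:R ^+ n * y }.

(* K0 = W[1/p]; the localization map iota is injective because W has no
   p-torsion. *)
Record is_invert_p (p : nat) (W : comNzRingType) (K0 : fieldType)
    (iota : {rmorphism W -> K0}) : Prop := IsInvertP {
  invert_p_inj : injective iota ;
  invert_p_unit : (p%:R : K0) != 0 ;
  invert_p_frac : forall x : K0,
    exists (w : W) (n : nat), x = iota w / p%:R ^+ n }.

Record is_nonarch_absval (R : realType) (K : fieldType) (abs : K -> R) : Prop :=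
  IsNonarchAbsval {
  absval_ge0 : forall x : K, 0 <= abs x ;
  absval_eq0 : forall x : K, abs x = 0 <-> x = 0 ;
  absvalM : forall x y : K, abs (x * y) = abs x * abs y ;
  absvalD : forall x y : K, abs (x + y) <= Num.max (abs x) (abs y) }.

(* The absolute value of K: the one extending the p-adic absolute value of K0,
   which sends p ^ n * w to c ^ n when w is not in pW.  The normalization
   c = |p| is left free in ]0, 1[. *)
Definition is_padic_absval (p : nat) (k : fieldType) (W : comNzRingType)
    (res : {rmorphism W -> k}) (K0 : fieldType) (iota : {rmorphism W -> K0})
    (R : realType) (K : fieldExtType K0) (abs : K -> R) : Prop :=
  is_nonarch_absval abs /\
  exists c : R, [/\ 0 < c, c < 1 &
    forall (n : nat) (w : W), res w != 0 ->
      abs ((iota (p%:R ^+ n * w))%:A) = c ^+ n].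

Section ValuedField.
Variables (R : realType) (K : fieldType) (abs : K -> R).

Definition integers : set K := [set x | abs x <= 1].

(* integers is a local ring: its maximal ideal is its set of non-units. *)
Definition maxideal : set K :=
  [set x | integers x /\ ~ exists y, integers y /\ x * y = 1].

(* (1 + m_K)^r, the O_K-points of the formal torus in multiplicative
   coordinates *)
Definition torus (r : nat) : set 'rV[K]_r :=
  [set Q | forall i, exists m, maxideal m /\ Q 0 i = 1 + m].

Definition sup_dist (r : nat) (P Q : 'rV[K]_r) : R :=
  \big[Num.max/0]_(i < r) abs (P 0 i - Q 0 i).

End ValuedField.

Definition torus_unit (K : fieldType) (r : nat) : 'rV[K]_r := const_mx 1.

Definition torus_mul (K : fieldType) (r : nat) (n : nat) (Q : 'rV[K]_r) :
    'rV[K]_r :=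
  map_mx (fun x : K => x ^+ n) Q.

Definition strict_contraction (R : realType) (T : Type) (d : T -> T -> R)
    (S : set T) (g : T -> T) : Prop :=
  (forall x, S x -> S (g x)) /\
  exists2 c : R, c < 1 &
    forall x y, S x -> S y -> d (g x) (g y) <= c * d x y.

Definition periodic_point (T : Type) (g : T -> T) (x : T) : Prop :=
  exists2 n : nat, (0 < n)%N & iter n g x = x.

(* Main.v *)
Require Import Defs.
From HB Require Import structures.
From mathcomp Require Import all_boot all_order all_algebra all_field.
From mathcomp Require Import all_classical all_reals all_analysis.
Import Order.TTheory GRing.Theory Num.Theory.
Import numFieldNormedType.Exports.
Local Open Scope classical_set_scope.
Local Open Scope ring_scope.

(** For x and y in 1 + m_K, the factorization
    x ^ q - y ^ q = (x - y) * \sum_(i < q) x ^ (q - 1 - i) * y ^ i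
    shows the contraction: every summand of the cofactor is congruent to 1
    modulo m_K, so the cofactor is congruent to q, which is itself in m_K.
    Hence |x ^ q - y ^ q| <= |x - y| * sup_(u in m_K) |u|
    ([dist_exprn_le]).

    What remains is that this supremum is < 1, and this is where the finiteness
    of K over K0 enters ([maxideal_uniform_bound]).  On K0 the nonzero absolute
    values are the integral powers of c = |p| ([absval_K0]).  With d = [K : K0],
    every u in K satisfies a nontrivial equation \sum_(i <= d) a_i u ^ i = 0
    over K0, and two nonzero terms of it must have the same absolute value, as
    otherwise the largest term could not be cancelled ([ultrametric_cancel]).
    So, if u is nonzero, some power |u| ^ e with 0 < e <= d is an integral power
    of c; if |u| < 1 this forces |u| ^ d <= |u| ^ e <= c, that is, |u| is at
    most the d-th root of c.

    Convergence of the orbits and uniqueness of the periodic point then follow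
    as for any contraction that has a fixed point, here the unit. *)

(** * Nonarchimedean absolute values *)

Lemma absval0 {R : realType} {K : fieldType} {abs : K -> R}
    (habs : is_nonarch_absval abs) : abs 0 = 0.
Proof. exact: (absval_eq0 habs 0).2. Qed.

Lemma absval_gt0 {R : realType} {K : fieldType} {abs : K -> R}
    (habs : is_nonarch_absval abs) (x : K) : x != 0 -> 0 < abs x.
Proof.
move=> x0; rewrite lt_neqAle absval_ge0 // andbT eq_sym.
by apply/eqP => /(absval_eq0 habs x); apply/eqP.
Qed.

Lemma absval1 {R : realType} {K : fieldType} {abs : K -> R}
    (habs : is_nonarch_absval abs) : abs 1 = 1.
Proof.
have a1 : abs 1 != 0 by rewrite gt_eqF// absval_gt0// oner_neq0.
by apply: (mulfI a1); rewrite -absvalM// !mulr1.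
Qed.

Lemma absvalN {R : realType} {K : fieldType} {abs : K -> R}
    (habs : is_nonarch_absval abs) (x : K) : abs (- x) = abs x.
Proof.
have : abs (- x) ^+ 2 = abs x ^+ 2 by rewrite !expr2 -!(absvalM habs) mulrNN.
by move/eqP; rewrite eqrXn2 ?absval_ge0// => /eqP.
Qed.

Lemma absvalX {R : realType} {K : fieldType} {abs : K -> R}
    (habs : is_nonarch_absval abs) (x : K) n : abs (x ^+ n) = abs x ^+ n.
Proof.
elim: n => [|n IHn]; first by rewrite !expr0 absval1.
by rewrite !exprS absvalM// IHn.
Qed.

Lemma absvalV {R : realType} {K : fieldType} {abs : K -> R}
    (habs : is_nonarch_absval abs) (x : K) : x != 0 -> abs x^-1 = (abs x)^-1.
Proof.
move=> x0; have a0 : abs x != 0 by rewrite gt_eqF// absval_gt0.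
by apply: (mulfI a0); rewrite -absvalM// !divff// absval1.
Qed.

Lemma absvalD_le {R : realType} {K : fieldType} {abs : K -> R}
    (habs : is_nonarch_absval abs) (x y : K) (b : R) :
  abs x <= b -> abs y <= b -> abs (x + y) <= b.
Proof.
by move=> xb yb; rewrite (le_trans (absvalD habs x y))// ge_max xb yb.
Qed.

Lemma absval_sum_le {R : realType} {K : fieldType} {abs : K -> R}
    (habs : is_nonarch_absval abs) (I : finType) (P : pred I) (F : I -> K)
    (b : R) :
  0 <= b -> (forall i, P i -> abs (F i) <= b) -> abs (\sum_(i | P i) F i) <= b.
Proof.
move=> b0 Fb; elim/big_ind: _ => //; first by rewrite absval0.
by move=> x y; exact: absvalD_le.
Qed.

(** A term of strictly largest absolute value could not be cancelled by the
    others, so the largest absolute value is attained at least twice. *)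
Lemma ultrametric_cancel {R : realType} {K : fieldType} {abs : K -> R}
    (habs : is_nonarch_absval abs) (I : finType) (F : I -> K) (i1 : I) :
  F i1 != 0 -> \sum_i F i = 0 ->
  exists i j, [/\ i != j, F i != 0, F j != 0 & abs (F i) = abs (F j)].
Proof.
move=> Fi1 F0.
have [i _ imax] := @arg_maxP _ R I i1 xpredT (fun i => abs (F i)) isT.
have Fi_gt0 : 0 < abs (F i).
  exact: lt_le_trans (absval_gt0 habs _ Fi1) (imax i1 isT).
have Fi : F i != 0.
  by apply/eqP => Fi; move: Fi_gt0; rewrite Fi absval0// ltxx.
have FiE : F i = - \sum_(j | j != i) F j.
  by apply/eqP; rewrite -addr_eq0; move/eqP: F0; rewrite (bigD1 i).
have [[j1 j1i]|noj] := pselect (exists j, j != i); last first.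
  move: Fi; rewrite FiE big1 ?oppr0 ?eqxx// => j ji.
  by case: noj; exists j.
have [j ji jmax] := @arg_maxP _ R I j1 (predC1 i) (fun i => abs (F i)) j1i.
have FjE : abs (F i) = abs (F j).
  apply/le_anti/andP; split; last exact: imax.
  rewrite FiE absvalN//.
  by apply: absval_sum_le => //; exact: absval_ge0.
exists i, j; split => //; first by rewrite eq_sym.
by apply/eqP => Fj; move: Fi_gt0; rewrite FjE Fj absval0// ltxx.
Qed.

Lemma maxidealE {R : realType} {K : fieldType} {abs : K -> R}
    (habs : is_nonarch_absval abs) (x : K) : maxideal abs x <-> abs x < 1.
Proof.
split=> [[x1 xV]|x1].
  rewrite lt_neqAle [X in _ && X]x1 andbT; apply/eqP => ax1.
  have x0 : x != 0.
    apply/eqP => x0; move: ax1; rewrite x0 absval0// => /eqP.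
    by rewrite eq_sym oner_eq0.
  apply: xV; exists x^-1; rewrite divff//; split=> //.
  by rewrite /integers/= absvalV// ax1 invr1.
split=> [|[y [y1 xy]]]; first exact: ltW.
have := absvalM habs x y; rewrite xy absval1// => /eqP; rewrite gt_eqF//.
by rewrite (le_lt_trans _ x1)// ler_piMr// absval_ge0.
Qed.

Lemma torusE {R : realType} {K : fieldType} {abs : K -> R}
    (habs : is_nonarch_absval abs) {r} (Q : 'rV[K]_r) :
  torus abs Q <-> forall i, abs (Q 0 i - 1) < 1.
Proof.
split=> [TQ i|Q1 i].
  by have [m [/(maxidealE habs) m1 ->]] := TQ i; rewrite addrC addKr.
by exists (Q 0 i - 1); split; [exact/(maxidealE habs)|rewrite addrC subrK].
Qed.

(** * The contraction estimate in one coordinate *)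

Lemma unit_ballM {R : realType} {K : fieldType} {abs : K -> R}
    (habs : is_nonarch_absval abs) (b : R) (x y : K) :
  b <= 1 -> abs (x - 1) <= b -> abs (y - 1) <= b -> abs (x * y - 1) <= b.
Proof.
move=> b1 xb yb.
have -> : x * y - 1 = (x - 1) * y + (y - 1).
  by rewrite mulrBl mul1r addrA subrK.
apply: absvalD_le => //; rewrite absvalM//.
rewrite (le_trans _ xb)// ler_piMr ?absval_ge0//.
rewrite -(subrK 1 y); apply: absvalD_le => //; first exact: le_trans yb b1.
by rewrite absval1.
Qed.

Lemma unit_ballX {R : realType} {K : fieldType} {abs : K -> R}
    (habs : is_nonarch_absval abs) (b : R) (x : K) n :
  0 <= b -> b <= 1 -> abs (x - 1) <= b -> abs (x ^+ n - 1) <= b.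
Proof.
move=> b0 b1 xb; elim: n => [|n IHn]; first by rewrite expr0 subrr absval0.
by rewrite exprS; exact: unit_ballM.
Qed.

Lemma dist_exprn_le {R : realType} {K : fieldType} {abs : K -> R}
    (habs : is_nonarch_absval abs) (b : R) (q : nat) (x y : K) :
  0 <= b -> b <= 1 -> abs q%:R <= b -> abs (x - 1) <= b -> abs (y - 1) <= b ->
  abs (x ^+ q - y ^+ q) <= b * abs (x - y).
Proof.
move=> b0 b1 qb xb yb.
rewrite subrXX absvalM// mulrC ler_wpM2r ?absval_ge0//.
(* the cofactor is q plus the deviations of its q summands from 1 *)
have -> : \sum_(i < q) x ^+ (q.-1 - i) * y ^+ i =
    \sum_(i < q) (x ^+ (q.-1 - i) * y ^+ i - 1) + q%:R.
  by rewrite sumrB sumr_const card_ord subrK.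
apply: absvalD_le => //; apply: absval_sum_le => // i _.
by apply: unit_ballM => //; exact: unit_ballX.
Qed.

(** * Discreteness of the absolute value of a finite extension *)

(** If no m were the last exponent with w in p ^ m W, then w would lie in every
    p ^ n W, and would vanish because W is p-adically separated. *)
Lemma Witt_factor {p : nat} {k : fieldType} {W : comNzRingType}
    {res : {rmorphism W -> k}} (hW : is_Witt p res) (w : W) :
  w != 0 -> exists m v, res v != 0 /\ w = p%:R ^+ m * v.
Proof.
move=> w0.
have [m [v wE] mmax] : exists2 m, (exists v, w = p%:R ^+ m * v) &
    ~ exists v, w = p%:R ^+ m.+1 * v.
  apply: contrapT => H; move/eqP: w0; apply; apply: (Witt_separated hW).
  elim=> [|n IHn]; first by exists w; rewrite expr0 mul1r.
  by apply: contrapT => Hn; apply: H; exists n.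
exists m, v; split => //; apply/eqP => /(Witt_res_ker hW) [y vE].
by apply: mmax; exists y; rewrite wE vE mulrA -exprSr.
Qed.

Lemma absval_K0 {p : nat} {k : fieldType} {W : comNzRingType}
    {res : {rmorphism W -> k}} (hW : is_Witt p res) {K0 : fieldType}
    {iota : {rmorphism W -> K0}} (hK0 : is_invert_p p iota)
    {K : fieldExtType K0} {R : realType} {abs : K -> R}
    (habs : is_nonarch_absval abs) (c : R)
    (hc : forall (n : nat) (w : W), res w != 0 ->
      abs ((iota (p%:R ^+ n * w))%:A) = c ^+ n) (a : K0) :
  a != 0 -> exists m n, abs a%:A = c ^+ m / c ^+ n.
Proof.
move=> a0; have [w [n aE]] := invert_p_frac hK0 a.
have w0 : w != 0.
  by apply: contraNneq a0 => w0; rewrite aE w0 rmorph0 mul0r.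
have [m [v [v0 wE]]] := Witt_factor hW w w0.
have pn0 : (p%:R ^+ n : K0) != 0 by rewrite expf_neq0// (invert_p_unit hK0).
have absp : abs (p%:R ^+ n : K0)%:A = c ^+ n.
  have := hc n 1; rewrite mulr1 rmorph1 oner_neq0 rmorphXn rmorph_nat.
  exact.
exists m, n; rewrite -(hc m v)// -absp -wE aE.
rewrite -[LHS]/(abs (in_alg K (_ / _))) rmorphM fmorphV/= absvalM// absvalV//.
by rewrite scaler_eq0 negb_or pn0 oner_neq0.
Qed.

(** The minimal polynomial of u has two terms of equal absolute value, so some
    |u| ^ e is the absolute value of an element of K0, with e at most the
    degree of u, hence at most [K : K0]. *)
Lemma maxideal_expn_le {p : nat} {k : fieldType} {W : comNzRingType}
    {res : {rmorphism W -> k}} (hW : is_Witt p res) {K0 : fieldType}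
    {iota : {rmorphism W -> K0}} (hK0 : is_invert_p p iota)
    {K : fieldExtType K0} {R : realType} {abs : K -> R}
    (habs : is_nonarch_absval abs) (c : R) (c0 : 0 < c) (c1 : c < 1)
    (hc : forall (n : nat) (w : W), res w != 0 ->
      abs ((iota (p%:R ^+ n * w))%:A) = c ^+ n) (u : K) :
  abs u < 1 -> abs u ^+ \dim {:K} <= c.
Proof.
move=> u1; have [->|u0] := eqVneq u 0.
  by rewrite absval0// expr0n gtn_eqF ?adim_gt0// ltW.
have au0 := absval_gt0 habs _ u0.
have [a [e [a0 e0 ed aE]]] : exists (a : K0) e,
    [/\ a != 0, (0 < e)%N, (e <= \dim {:K})%N & abs u ^+ e = abs a%:A].
  pose P := minPoly 1 u.
  have sP : size P = (adjoin_degree 1 u).+1 by exact: size_minPoly.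
  have dP : (adjoin_degree 1 u <= \dim {:K})%N.
    have := dim_Fadjoin 1 u; rewrite dimv1 muln1 => <-.
    exact/dimvS/subvf.
  pose F (i : 'I_(size P)) := P`_i * u ^+ i.
  have F0 : \sum_i F i = 0.
    by have := root_minPoly 1 u; rewrite /root horner_coef => /eqP.
  have lastP : ((size P).-1 < size P)%N by rewrite sP.
  have Flast : F (Ordinal lastP) != 0.
    have := monic_minPoly 1 u; rewrite monicE /F /= => /eqP.
    by rewrite lead_coefE => ->; rewrite mul1r expf_neq0.
  have coefE (i : 'I_(size P)) : exists a : K0, P`_i = a%:A.
    by apply/vlineP; have /polyOverP := minPolyOver 1 u; exact.
  have [i [j [ij Fi Fj FE]]] := ultrametric_cancel habs _ F _ Flast F0.
  wlog ltij : i j ij Fi Fj FE / (i < j)%N.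
    move=> H; have [|ji] := ltnP i j; first exact: (H i j).
    apply: (H j i) => //; first by rewrite eq_sym.
    by rewrite ltn_neqAle eq_sym ij.
  have [[a aE] [b bE]] := (coefE i, coefE j).
  have an0 : a != 0.
    by apply: contraNneq Fi => a0; rewrite /F aE a0 scale0r mul0r.
  have bn0 : b != 0.
    by apply: contraNneq Fj => b0; rewrite /F bE b0 scale0r mul0r.
  have bA0 : (b%:A : K) != 0 by rewrite scaler_eq0 negb_or bn0 oner_neq0.
  exists (a / b), (j - i)%N; split.
  - by rewrite mulf_neq0// invr_eq0.
  - by rewrite subn_gt0.
  - rewrite (leq_trans (leq_subr _ _))// (leq_trans _ dP)// -ltnS -sP.
    exact: ltn_ord.
  - rewrite -[RHS]/(abs (in_alg K (_ / _))) rmorphM fmorphV/=.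
    rewrite absvalM// absvalV//.
    have aun : abs u ^+ i != 0 by rewrite expf_neq0// gt_eqF.
    have abn : abs b%:A != 0 by rewrite gt_eqF// absval_gt0.
    move: FE; rewrite /F aE bE !(absvalM habs) !(absvalX habs) -(subnKC (ltnW ltij)).
    rewrite addKn exprD mulrCA mulrC => /(mulfI aun) ->.
    by rewrite mulrC mulKf.
have [m [n mnE]] := absval_K0 hW hK0 habs c hc a a0.
have ue1 : abs u ^+ e < 1 by rewrite exprn_ilt1// ?ltW// -lt0n.
(* an integral power of c that is < 1 has a positive exponent *)
have nm : (n < m)%N.
  rewrite ltnNge; apply/negP => mn; move: ue1; rewrite aE mnE ltNge.
  by rewrite ler_pdivlMr ?exprn_gt0// mul1r ler_wiXn2l// ltW.
rewrite (@le_trans _ _ (abs u ^+ e))//; first by rewrite ler_wiXn2l// ltW.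
rewrite aE mnE -(subnK nm) addnS -addSn exprD mulfK; last first.
  by rewrite expf_neq0// gt_eqF.
by rewrite exprS ler_piMr ?exprn_ile1// ltW.
Qed.

Lemma maxideal_uniform_bound {p : nat} {k : fieldType} {W : comNzRingType}
    {res : {rmorphism W -> k}} (hW : is_Witt p res) {K0 : fieldType}
    {iota : {rmorphism W -> K0}} (hK0 : is_invert_p p iota)
    {K : fieldExtType K0} {R : realType} {abs : K -> R}
    (habs : is_padic_absval p res iota abs) :
  exists b : R, [/\ 0 <= b, b < 1 & forall u, abs u < 1 -> abs u <= b].
Proof.
case: habs => habs [c [c0 c1 hc]].
have d0 : (0 < \dim {:K})%N := adim_gt0 _.
pose b := c `^ (\dim {:K})%:R^-1.
have b0 : 0 <= b by exact: powR_ge0.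
have bE : b ^+ \dim {:K} = c.
  rewrite -powR_mulrn// -powRrM mulVf ?pnatr_eq0 -?lt0n//.
  by rewrite powRr1// ltW.
exists b; split => //; first by rewrite -(expr_lt1 d0)// bE.
move=> u u1; rewrite -(@ler_pXn2r _ (\dim {:K}))// ?nnegrE ?absval_ge0//.
by rewrite bE; exact: (maxideal_expn_le hW hK0 habs c c0 c1 hc u u1).
Qed.

(** This makes the number q of summands of the cofactor in [dist_exprn_le] an
    element of m_K. *)
Lemma absval_pexp_lt1 {p : nat} {k : fieldType} {W : comNzRingType}
    {res : {rmorphism W -> k}} {K0 : fieldType}
    {iota : {rmorphism W -> K0}}
    {K : fieldExtType K0} {R : realType} {abs : K -> R}
    (habs : is_padic_absval p res iota abs) (f : nat) :
  (0 < f)%N -> abs (p ^ f)%:R < 1.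
Proof.
case: habs => _ [c [c0 c1 hc]] f0.
have := hc f 1; rewrite mulr1 rmorph1 oner_neq0 rmorphXn rmorph_nat -natrX.
rewrite -[X in abs X]/(in_alg K _) rmorph_nat => ->//.
by rewrite exprn_ilt1// ?ltW// -lt0n.
Qed.

(** * The sup distance *)

Lemma sup_dist_ge0 {R : realType} {K : fieldType} (abs : K -> R) {r}
    (P Q : 'rV[K]_r) : 0 <= sup_dist abs P Q.
Proof. exact: bigmax_ge_id. Qed.

Lemma sup_dist_ge {R : realType} {K : fieldType} (abs : K -> R) {r}
    (P Q : 'rV[K]_r) i : abs (P 0 i - Q 0 i) <= sup_dist abs P Q.
Proof. by rewrite /sup_dist; exact: le_bigmax. Qed.

Lemma sup_dist_eq0 {R : realType} {K : fieldType} {abs : K -> R}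
    (habs : is_nonarch_absval abs) {r} (P Q : 'rV[K]_r) :
  sup_dist abs P Q <= 0 -> P = Q.
Proof.
move=> PQ; apply/rowP => i; apply/eqP; rewrite -subr_eq0; apply/eqP.
apply/(absval_eq0 habs)/le_anti; rewrite absval_ge0// andbT.
exact: le_trans (sup_dist_ge abs P Q i) PQ.
Qed.

Lemma sup_dist_torus_mul {R : realType} {K : fieldType} {abs : K -> R}
    (habs : is_nonarch_absval abs) (b : R) (q : nat) {r : nat} (P Q : 'rV[K]_r) :
  0 <= b -> b <= 1 -> (forall u, abs u < 1 -> abs u <= b) ->
  abs q%:R < 1 -> torus abs P -> torus abs Q ->
  sup_dist abs (torus_mul q P) (torus_mul q Q) <= b * sup_dist abs P Q.
Proof.
move=> b0 b1 ub q1 /(torusE habs) TP /(torusE habs) TQ.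
apply: bigmax_le => [|i _]; first by rewrite mulr_ge0// sup_dist_ge0.
rewrite !mxE (le_trans (dist_exprn_le habs b q _ _ b0 b1 _ _ _)) ?ub//.
by rewrite ler_wpM2l// sup_dist_ge.
Qed.

Lemma torus_torus_mul {R : realType} {K : fieldType} {abs : K -> R}
    (habs : is_nonarch_absval abs) (b : R) (q : nat) {r : nat} (Q : 'rV[K]_r) :
  0 <= b -> b < 1 -> (forall u, abs u < 1 -> abs u <= b) ->
  torus abs Q -> torus abs (torus_mul q Q).
Proof.
move=> b0 b1 ub /(torusE habs) TQ; apply/(torusE habs) => i; rewrite mxE.
by rewrite (le_lt_trans (unit_ballX habs b _ q b0 (ltW b1) _))// ub.
Qed.

Lemma torus_mul_unit (K : fieldType) (r q : nat) :
  torus_mul q (torus_unit K r) = torus_unit K r.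
Proof. by apply/rowP => i; rewrite !mxE expr1n. Qed.

Lemma torus_torus_unit {R : realType} {K : fieldType} {abs : K -> R}
    (habs : is_nonarch_absval abs) r : torus abs (torus_unit K r).
Proof. by apply/(torusE habs) => i; rewrite mxE subrr absval0. Qed.

(** * Orbits of a contraction with a fixed point *)

Lemma iter_contraction_le {R : realType} {T : Type} {d : T -> T -> R}
    {S : set T} {g : T -> T} {b : R} {x0 : T} :
  0 <= b -> (forall x, S x -> S (g x)) ->
  (forall x y, S x -> S y -> d (g x) (g y) <= b * d x y) ->
  S x0 -> g x0 = x0 ->
  forall x n, S x -> d (iter n g x) x0 <= b ^+ n * d x x0.
Proof.
move=> b0 gS gd Sx0 gx0 x n Sx.
have Sn m : S (iter m g x) by elim: m => //= m; exact: gS.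
elim: n => [|n IHn]; first by rewrite expr0 mul1r.
rewrite iterS -[X in d _ X]gx0 (le_trans (gd _ _ (Sn n) Sx0))//.
by rewrite exprS -mulrA ler_wpM2l.
Qed.

(** * Multiplication by q on the formal torus *)

Theorem proposition5p1
    (p f q r : nat) (hp : prime p) (hp_odd : odd p)
    (hf : (1 <= f)%N) (hq : q = (p ^ f)%N) (hr : (1 <= r)%N)
    (k : finFieldType) (hk : #|k| = q)
    (W : comNzRingType) (res : {rmorphism W -> k}) (hW : is_Witt p res)
    (K0 : fieldType) (iota : {rmorphism W -> K0}) (hK0 : is_invert_p p iota)
    (K : fieldExtType K0)
    (R : realType) (abs : K -> R) (habs : is_padic_absval p res iota abs) :
  [/\ strict_contraction (@sup_dist R K abs r) (@torus R K abs r)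
        (@torus_mul K r q),
      (forall Q : 'rV[K]_r, torus abs Q ->
        (fun n : nat => sup_dist abs (iter n (@torus_mul K r q) Q)
                                 (torus_unit K r)) @ \oo --> (0 : R)) &
      [set Q : 'rV[K]_r | torus abs Q /\ periodic_point (@torus_mul K r q) Q]
        = [set torus_unit K r] ].
Proof.
have [b [b0 b1 ub]] := maxideal_uniform_bound hW hK0 habs.
have q1 : abs q%:R < 1 by rewrite hq; exact: absval_pexp_lt1 habs f hf.
have na : is_nonarch_absval abs := habs.1.
have stable Q : torus abs Q -> torus abs (@torus_mul K r q Q).
  exact: (torus_torus_mul na b q Q b0 b1 ub).
have contr (P Q : 'rV[K]_r) : torus abs P -> torus abs Q ->
    sup_dist abs (torus_mul q P) (torus_mul q Q) <= b * sup_dist abs P Q.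
  exact: (sup_dist_torus_mul na b q P Q b0 (ltW b1) ub q1).
have orbit := iter_contraction_le b0 stable contr (torus_torus_unit na r)
  (torus_mul_unit K r q).
split.
- by split => //; exists b.
- move=> Q TQ.
  apply: (@squeeze_cvgr _ _ _ _ (cst 0)
      (fun n => b ^+ n * sup_dist abs Q (torus_unit K r))).
  + by apply: nearW => n; rewrite sup_dist_ge0 orbit.
  + exact: cvg_cst.
  + rewrite -[X in _ --> X](mul0r (sup_dist abs Q (torus_unit K r))).
    by apply: cvgMl; apply: cvg_expr; rewrite ger0_norm.
- apply/seteqP; split => [Q [TQ [n n0 nQ]]|Q ->] /=; last first.
    split; first exact: torus_torus_unit.
    by exists 1%N => //=; exact: torus_mul_unit.
  (* a point that returns after n steps is at distance d with d <= b ^ n * d *)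
  apply: (sup_dist_eq0 na); have := orbit Q n TQ; rewrite nQ.
  set d := sup_dist _ _ _ => dle.
  have bn1 : b ^+ n < 1 by rewrite exprn_ilt1// -lt0n.
  rewrite leNgt; apply/negP => d0; move: dle.
  by rewrite leNgt -[X in _ < X]mul1r ltr_pM2r// bn1.
Qed.
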